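(* Let $n=2$, let $f(x)=\frac12 x^TAx-b^Tx$ with $A\in\mathbb{R}^{2\times 2}$ symmetric positive definite and $b\in\mathbb{R}^2$, and let $\Psi$ and $\Psi_1$ be two (possibly different) admissible functions for $A$. Let $k_0\ge2$ be an integer and $r\in\mathbb{R}$. Suppose that the gradient method $x_{k+1}=x_k-\alpha_kg_k$, $g_k=\nabla f(x_k)$, is applied to minimize $f$ with $$\alpha_k=\alpha_k(\Psi(A))\quad\text{for all } k\ne k_0 \text{ and } k\neq k_0-1,$$ and uses the stepsizes $\alpha_{k_0-1}=\alpha_{k_0-1}(\Psi_1(A))$ and $\alpha_{k_0}=\tilde\alpha_{k_0}(\Psi_1(A))$ at the $(k_0-1)$-th and $k_0$-th iterations, respectively. Here, for an admissible function $\Phi$, $$\alpha_k(\Phi(A))=\frac{g_{k-1}^T\Phi(A)g_{k-1}}{g_{k-1}^T\Phi(A)Ag_{k-1}}$$ and $$\tilde\alpha_{k}(\Phi(A))=\frac{2}{\left(H_{k}^{(11)}+H_{k}^{(22)}\right)+\sqrt{\left(H_{k}^{(11)}-H_{k}^{(22)}\right)^2+4\left(H_{k}^{(12)}\right)^2}},$$ where $H_k=H_k(\Phi)$ is the $2\times 2$ matrix defined in the context (with the given $r$). Then the method finds the minimizer of $f$ in at most $k_0+3$ iterations, i.e. $g_j=0$ for some $j\le k_0+3$.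
   Context: Admissible function: let $\lambda_1$ and $\lambda_n$ be the smallest and largest eigenvalues of $A$. An admissible function $\Phi$ is a real analytic function on $[\lambda_1,\lambda_n]$ that can be expressed by a Laurent series $\Phi(z)=\sum_{j=-\infty}^{\infty}c_jz^j$, $c_j\in\mathbb{R}$, with $0<\Phi(z)<+\infty$ for all $z\in[\lambda_1,\lambda_n]$. Thus $\Phi(A)$ is symmetric positive definite, and for $r\in\mathbb{R}$, $\Phi^r(A)$ denotes the matrix power $(\Phi(A))^r$. Iterations: the iterates are $x_0,x_1,x_2,\dots$ with $x_0$ arbitrary. The formula $\alpha_k(\Phi(A))$ makes sense for $k\ge1$; the initial stepsize $\alpha_0>0$ is arbitrary. The method stops as soon as some $g_j=0$, i.e. $x_j$ is the minimizer. The vector $q_{k-1}$: for $k\ge 2$, $q_{k-1}\in\mathbb{R}^n$ denotes a vector satisfying $(I-\alpha_{k-2}A)q_{k-1}=g_{k-2}$, where $\alpha_{k-2}$ is the stepsize actually used at iteration $k-2$. The matrix $H_k(\Phi)$: for $k\ge2$ and $r\in\mathbb{R}$, $$H_k=\begin{pmatrix}\dfrac{q_{k-1}^T\Phi^{2r}(A)Aq_{k-1}}{\|\Phi^r(A)q_{k-1}\|^2} & \dfrac{q_{k-1}^T\Phi(A)Ag_k}{\|\Phi^r(A)q_{k-1}\|\,\|\Phi^{1-r}(A)g_k\|}\\[2ex] \dfrac{q_{k-1}^T\Phi(A)Ag_k}{\|\Phi^r(A)q_{k-1}\|\,\|\Phi^{1-r}(A)g_k\|} & \dfrac{g_k^T\Phi^{2(1-r)}(A)Ag_k}{\|\Phi^{1-r}(A)g_k\|^2}\end{pmatrix},$$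 with entries denoted $H_k^{(ij)}$, and $\|\cdot\|$ the Euclidean norm. Standing assumption: if the method has not stopped by iteration $k_0$ (i.e. $g_j\ne0$ for all $j\le k_0$), then a vector $q_{k_0-1}\in\mathbb{R}^n$ satisfying $(I-\alpha_{k_0-2}A)q_{k_0-1}=g_{k_0-2}$, where $\alpha_{k_0-2}$ is the stepsize actually used at iteration $k_0-2$, exists, and $\Psi_1^r(A)q_{k_0-1}$ and $\Psi_1^{1-r}(A)g_{k_0}$ are nonzero, so that $H_{k_0}(\Psi_1)$ is defined. *)

(* Defs.v *)
From HB Require Import structures.
From mathcomp Require Import all_boot all_order all_algebra.
From mathcomp Require Import all_classical all_reals all_analysis.
From mathcomp Require Import ring.

Set Implicit Arguments.
Unset Strict Implicit.
Unset Printing Implicit Defensive.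

Import Order.TTheory GRing.Theory Num.Theory.
Import numFieldNormedType.Exports.

Local Open Scope classical_set_scope.
Local Open Scope ring_scope.

Section Euclidean.
Variables (R : realType) (n : nat).
Implicit Types (u v x b : 'cV[R]_n) (A : 'M[R]_n).

Definition dot u v : R := (u^T *m v) 0 0.

(* The library norm on matrices is the sup norm, hence this definition. *)
Definition enorm u : R := Num.sqrt (dot u u).

Definition sym_posdef A : Prop :=
  A^T = A /\ forall u, u != 0 -> 0 < dot u (A *m u).

Definition quadratic A b x : R := 2^-1 * dot x (A *m x) - dot b x.

Definition gradient (f : 'cV[R]_n -> R) x : 'cV[R]_n :=
  \col_i 'D_(delta_mx i 0) f x.

Definition smallest_eigenvalue A (l : R) : Prop :=
  eigenvalue A l /\ forall m, eigenvalue A m -> l <= m.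

Definition largest_eigenvalue A (l : R) : Prop :=
  eigenvalue A l /\ forall m, eigenvalue A m -> m <= l.

End Euclidean.

Section MatrixFunctions.
Variables (R : realType) (n : nat).
Implicit Types (A P : 'M[R]_n) (d : 'rV[R]_n) (f : R -> R).

Definition spectral_decomposition A P d : Prop :=
  P *m P^T = 1%:M /\ A = P^T *m diag_mx d *m P.

(* f(A) for A symmetric, by functional calculus: f is applied to the
   eigenvalues in an orthonormal diagonalization of A. The result does not
   depend on the diagonalization (matfunE); for f given by a Laurent series
   it is the sum of the corresponding series in A (matfun_laurent). The value
   is 0 if A has no orthonormal diagonalization, i.e. is not symmetric. *)
Definition matfun f A : 'M[R]_n :=
  xget 0 [set F | exists P d, spectral_decomposition A P d /\
                    F = P^T *m diag_mx (map_mx f d) *m P].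

Definition matpow A (r : R) : 'M[R]_n := matfun (fun t => t `^ r) A.

Lemma matfunE f A P d : spectral_decomposition A P d ->
  matfun f A = P^T *m diag_mx (map_mx f d) *m P.
Proof.
move=> AP; rewrite /matfun; case: xgetP => [F _|/(_ (P^T *m diag_mx (map_mx f d) *m P))]; last first.
  by case; exists P, d.
move=> [Q [e [[QQ AQ] ->]]]; case: AP => PP AP.
have PP' : P^T *m P = 1%:M by apply: mulmx1C.
have QQ' : Q^T *m Q = 1%:M by apply: mulmx1C.
pose U := Q *m P^T.
have eU : diag_mx e *m U = U *m diag_mx d.
  have : Q *m A *m P^T = diag_mx e *m U.
    by rewrite AQ !mulmxA QQ mul1mx -mulmxA.
  by move=> <-; rewrite AP !mulmxA -(mulmxA _ P P^T) PP mulmx1.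
have fU : diag_mx (map_mx f e) *m U = U *m diag_mx (map_mx f d).
  apply/matrixP => i j; move/matrixP: eU => /(_ i j).
  rewrite !mul_diag_mx !mul_mx_diag !mxE mulrC.
  have [->|/mulfI /[apply] ->] := eqVneq (\sum_j0 Q i j0 * P^T j0 j) 0.
    by rewrite !(mulr0, mul0r).
  by rewrite mulrC.
have UU : U^T *m U = 1%:M.
  by rewrite /U trmx_mul trmxK mulmxA -(mulmxA P) QQ' mulmx1.
have -> : Q = U *m P by rewrite /U -mulmxA PP' mulmx1.
clearbody U; rewrite trmx_mul -!mulmxA; congr (_ *m _).
by rewrite (mulmxA (diag_mx _) U) fU !mulmxA UU mul1mx.
Qed.

End MatrixFunctions.

Section Admissible.
Variable R : realType.
Implicit Types (S : set R) (f Phi : R -> R).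

(* On S = [l1, l2] the expansions at the endpoints are one-sided; this is
   equivalent to analyticity on a neighbourhood of the interval. *)
Definition real_analytic_on S f : Prop :=
  forall z0, S z0 -> exists (a : nat -> R) (rho : R), 0 < rho /\
    forall z, S z -> `|z - z0| < rho ->
      series (fun j => a j * (z - z0) ^+ j) @ \oo --> f z.

(* The parts with j >= 0 (Posz j = j) and with j < 0 (Negz j = - j.+1) of the
   series over the integers converge separately. *)
Definition laurent_sum (c : int -> R) (z s : R) : Prop :=
  exists s1 s2 : R,
    [/\ series (fun j : nat => c (Posz j) * z ^ Posz j) @ \oo --> s1,
        series (fun j : nat => c (Negz j) * z ^ Negz j) @ \oo --> s2 &
        s = s1 + s2].

Definition admissible (l1 l2 : R) Phi : Prop :=
  [/\ real_analytic_on `[l1, l2] Phi,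
      exists c : int -> R, forall z, z \in `[l1, l2] -> laurent_sum c z (Phi z) &
      forall z, z \in `[l1, l2] -> 0 < Phi z].

End Admissible.

Lemma spectral_exp (R : realType) n (A P : 'M[R]_n.+1) d (m : nat) : spectral_decomposition A P d ->
  A ^+ m = P^T *m diag_mx (map_mx (fun t => t ^+ m) d) *m P.
Proof.
move=> [PP ->]; have PP' : P^T *m P = 1%:M by apply: mulmx1C.
elim: m => [|m IH].
  rewrite expr0; have -> : diag_mx (map_mx (fun t : R => t ^+ 0) d) = 1%:M.
    by apply/matrixP => i j; rewrite !mxE.
  by rewrite mulmx1 PP'.
rewrite exprS IH -mulmxE !mulmxA -(mulmxA _ P P^T) PP mulmx1.
rewrite -(mulmxA _ (diag_mx d)) mulmx_diag.
congr (_ *m diag_mx _ *m _); apply/matrixP => i j.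
by rewrite !mxE !ord1 exprS.
Qed.

Lemma spectral_inv (R : realType) n (A P : 'M[R]_n.+1) d : spectral_decomposition A P d ->
  (forall i, d 0 i != 0) ->
  spectral_decomposition A^-1 P (map_mx (fun t => t^-1) d).
Proof.
move=> [PP ->] d0; split => //; have PP' : P^T *m P = 1%:M by apply: mulmx1C.
suff H : (P^T *m diag_mx d *m P) *m (P^T *m diag_mx (map_mx (fun t : R => t^-1) d) *m P) = 1%:M.
  have [U _] := mulmx1_unit H.
  by apply: (mulrI U); rewrite divrr //; exact: esym H.
rewrite !mulmxA -(mulmxA _ P P^T) PP mulmx1 -(mulmxA _ (diag_mx d)) mulmx_diag.
have -> : diag_mx (\row_i (d 0 i * map_mx (fun t : R => t^-1) d 0 i)) = 1%:M.
  apply/matrixP => i j; rewrite !mxE; case: (i == j) => //.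
  by rewrite divff ?d0.
by rewrite mulmx1.
Qed.

Lemma spectral_expz (R : realType) n (A P : 'M[R]_n.+1) d (m : int) : spectral_decomposition A P d ->
  (forall i, d 0 i != 0) ->
  A ^ m = P^T *m diag_mx (map_mx (fun t => t ^ m) d) *m P.
Proof.
move=> AP d0; case: m => m; first exact: spectral_exp.
rewrite NegzE -exprnN -exprVn (spectral_exp _ (spectral_inv AP d0)).
congr (_ *m diag_mx _ *m _); apply/matrixP => i j.
by rewrite !mxE -exprnN -exprVn.
Qed.

Lemma cvg_series_matfun (R : realType) n (P : 'M[R]_n.+1) (d : 'rV[R]_n.+1)
    (h : nat -> R -> R) (f : R -> R) :
  (forall i, series (fun m => h m (d 0 i)) @ \oo --> f (d 0 i)) ->
  forall i j, series (fun m => (P^T *m diag_mx (map_mx (h m) d) *m P) i j) @ \oo -->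
    (P^T *m diag_mx (map_mx f d) *m P) i j.
Proof.
move=> hf i j.
have E g : (P^T *m diag_mx (map_mx g d) *m P) i j = \sum_k g (d 0 k) * (P k i * P k j).
  rewrite mxE; apply: eq_bigr => k _; rewrite mul_mx_diag !mxE; ring.
rewrite E.
have -> : series (fun m => (P^T *m diag_mx (map_mx (h m) d) *m P) i j) =
   (fun N => \sum_k series (fun m => h m (d 0 k)) N * (P k i * P k j)).
  apply/funext => N; rewrite /series/=.
  under eq_bigr do rewrite E.
  rewrite exchange_big/=; apply: eq_bigr => k _; by rewrite mulr_suml.
apply: (cvg_big (x0 := 0) (op := +%R)) => [|k _]; first exact: add_continuous.
apply: cvgMr_tmp; exact: hf.
Qed.

(* A Laurent series of f converging on the spectrum of A converges at A,
   entrywise, to matfun f A. *)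
Lemma matfun_laurent (R : realType) n (A P : 'M[R]_n.+1) d (c : int -> R) f :
  spectral_decomposition A P d -> (forall i, d 0 i != 0) ->
  (forall i, laurent_sum c (d 0 i) (f (d 0 i))) ->
  exists S1 S2 : 'M[R]_n.+1,
  [/\ forall i j, series (fun m : nat => (c (Posz m) *: A ^ Posz m) i j) @ \oo --> S1 i j,
     forall i j, series (fun m : nat => (c (Negz m) *: A ^ Negz m) i j) @ \oo --> S2 i j &
  matfun f A = S1 + S2].
Proof.
move=> AP d0 L.
have K (e : nat -> int) : (forall i, exists s, series (fun m => c (e m) * (d 0 i) ^ (e m)) @ \oo --> (s : R)) ->
  forall i j, series (fun m => (c (e m) *: A ^ e m) i j) @ \oo -->
   (P^T *m diag_mx (map_mx (fun t => limn (series (fun m => c (e m) * t ^ (e m)))) d) *m P) i j.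
  move=> H i j; have -> : (fun m => (c (e m) *: A ^ e m) i j) = fun m =>
    (P^T *m diag_mx (map_mx (fun t => c (e m) * t ^ e m) d) *m P) i j.
    apply/funext => m; rewrite (spectral_expz _ AP d0) scalemxAl scalemxAr.
    congr ((_ *m _ *m _) _ _); apply/matrixP => i' j'; rewrite !mxE.
    by rewrite mulrnAr.
  apply: (cvg_series_matfun (h := fun m t => c (e m) * t ^ e m)
    (f := fun t => limn (series (fun m => c (e m) * t ^ e m)))) => k.
  by have [s Hs] := H k; rewrite (cvg_lim _ Hs).
pose l (e : nat -> int) t := limn (series (fun m => c (e m) * t ^ (e m))).
exists (P^T *m diag_mx (map_mx (l Posz) d) *m P), (P^T *m diag_mx (map_mx (l Negz) d) *m P).
split.
- by apply: K => i; have [s1 [s2 []]] := L i; exists s1.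
- by apply: K => i; have [s1 [s2 []]] := L i; exists s2.
rewrite (matfunE _ AP) -mulmxDl -mulmxDr; congr (_ *m _ *m _).
apply/matrixP => i j; rewrite !mxE -mulrnDl; congr (_ *+ _).
have [s1 [s2 [h1 h2 ->]]] := L i; rewrite /l.
by rewrite (cvg_lim _ h1) ?(cvg_lim _ h2).
Qed.

Section Stepsizes.
Variables (R : realType) (n : nat).
Implicit Types (A : 'M[R]_n) (Phi : R -> R) (q g : 'cV[R]_n) (r : R).

(* In alpha_k(Phi(A)) the vector g is the previous gradient g_{k-1}. *)
Definition stepsize A Phi g : R :=
  dot g (matfun Phi A *m g) / dot g (matfun Phi A *m A *m g).

Definition Hmx A Phi r q g : 'M[R]_2 :=
  let FA := matfun Phi A in
  let nq := enorm (matpow FA r *m q) in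
  let ng := enorm (matpow FA (1 - r) *m g) in
  let h11 := dot q (matpow FA (2 * r) *m A *m q) / nq ^+ 2 in
  let h12 := dot q (FA *m A *m g) / (nq * ng) in
  let h22 := dot g (matpow FA (2 * (1 - r)) *m A *m g) / ng ^+ 2 in
  \matrix_(i, j) if i != j then h12 else if i == 0 then h11 else h22.

Definition stepsize_tilde (H : 'M[R]_2) : R :=
  2 / ((H 0 0 + H 1 1)
       + Num.sqrt ((H 0 0 - H 1 1) ^+ 2 + 4 * (H 0 1) ^+ 2)).

(* The method has not stopped by iteration k. *)
Definition running (g : nat -> 'cV[R]_n) (k : nat) : Prop :=
  forall j, (j <= k)%N -> g j != 0.

End Stepsizes.

(* Main.v *)
Require Import Defs.
From mathcomp Require Import all_boot all_order all_algebra.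
From mathcomp Require Import all_classical all_reals all_analysis.
From mathcomp Require Import ring lra zify.

Import Order.TTheory GRing.Theory Num.Theory.
Import numFieldNormedType.Exports.

Local Open Scope ring_scope.

(** Write h, g', g for the gradients at iterations k0 - 2, k0 - 1, k0, let a be
the step taken at iteration k0 - 2, and let F = Psi1(A). Gradients obey
g_{k+1} = (I - alpha_k A) g_k, so g = (I - a A) (h - alpha_{k0-1} A h), while
h = (I - a A) q. All these matrices commute and are symmetric, hence
q^T F g = h^T F (h - alpha_{k0-1} A h), and this vanishes precisely because
alpha_{k0-1} is the quotient h^T F h / h^T F A h. In other words F^r q and
F^{1-r} g are orthogonal.

After normalization these two vectors form an orthonormal basis of the plane,
and H_{k0} is the matrix of A in it (Hmx is a compression of A, see
compression_spectral). So H_{k0} has the spectrum of A, and the formula for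
the modified step is the inverse of the larger root of the characteristic
polynomial, written with trace and determinant: alpha_{k0} is the inverse of
the largest eigenvalue of A (stepsize_tilde_orthogonal). The step k0 therefore
kills the component of g along that eigenvector, and by Cayley-Hamilton
(spectral_plane_annihilator) the gradient k0 + 1 is an eigenvector for the
smallest eigenvalue l1. The next step keeps it in that eigenspace. The step
k0 + 2 is a quotient computed from the gradient k0 + 1, so it equals 1 / l1
(stepsize_eigenvector), and the gradient k0 + 3 is zero.

Functions of A are handled through one fixed orthonormal eigenbasis P of A:
each of them is spectral_decomposition _ P _, which makes products, commutation
and positivity computations on the diagonals. *)

(** * Euclidean inner product and gradient of a quadratic function *)

Section InnerProduct.
Context {R : realType} {n : nat}.
Implicit Types (u v w x b : 'cV[R]_n) (M A : 'M[R]_n) (c : R).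

Lemma dotE u v : dot u v = \sum_i u i 0 * v i 0.
Proof. by rewrite /dot mxE; apply: eq_bigr => i _; rewrite mxE. Qed.

Lemma dotC u v : dot u v = dot v u.
Proof. by rewrite !dotE; apply: eq_bigr => i _; rewrite mulrC. Qed.

Lemma dotDl u v w : dot (u + v) w = dot u w + dot v w.
Proof. by rewrite /dot linearD/= mulmxDl mxE. Qed.

Lemma dotZl c u v : dot (c *: u) v = c * dot u v.
Proof. by rewrite /dot linearZ/= -scalemxAl mxE. Qed.

Lemma dotDr u v w : dot u (v + w) = dot u v + dot u w.
Proof. by rewrite /dot mulmxDr mxE. Qed.

Lemma dotZr c u v : dot u (c *: v) = c * dot u v.
Proof. by rewrite /dot -scalemxAr mxE. Qed.

Lemma dotBr u v w : dot u (v - w) = dot u v - dot u w.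
Proof. by rewrite dotDr -scaleN1r dotZr mulN1r. Qed.

Lemma dot_mulmx M u v : dot u (M *m v) = dot (M^T *m u) v.
Proof. by rewrite /dot trmx_mul trmxK mulmxA. Qed.

Lemma dot_delta u i : dot u (delta_mx i 0) = u i 0.
Proof.
rewrite dotE (bigD1 i)//= big1 => [|j ji]; rewrite !mxE ?eqxx ?mulr1 ?addr0//.
by rewrite (negPf ji) mulr0.
Qed.

Lemma dot_ge0 u : 0 <= dot u u.
Proof. by rewrite dotE; apply: sumr_ge0 => i _; rewrite -expr2 sqr_ge0. Qed.

Lemma dot_gt0 u : u != 0 -> 0 < dot u u.
Proof.
move=> u0; rewrite lt_neqAle dot_ge0 andbT eq_sym; apply: contra u0.
rewrite dotE psumr_eq0 => [/allP u0|i _]; last by rewrite -expr2 sqr_ge0.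
apply/eqP/matrixP => i j; rewrite ord1 mxE; apply/eqP.
by have := u0 i (mem_index_enum i); rewrite mulf_eq0 orbb.
Qed.

Lemma enorm_gt0 u : u != 0 -> 0 < enorm u.
Proof. by move=> u0; rewrite sqrtr_gt0 dot_gt0. Qed.

Lemma sqr_enorm u : enorm u ^+ 2 = dot u u.
Proof. by rewrite sqr_sqrtr ?dot_ge0. Qed.

(** The difference quotient of a quadratic function along v is affine in the
increment h, with leading term the inner product of A x - b with v and linear
coefficient c; its limit at 0 is read off. *)
Lemma gradient_quadratic A b x : A^T = A ->
  gradient (quadratic A b) x = A *m x - b.
Proof.
move=> As; apply/matrixP => i j; rewrite ord1 mxE.
set v := delta_mx i 0; pose c := 2^-1 * dot v (A *m v).
have -> : (A *m x - b) i 0 = dot (A *m x - b) v by rewrite dot_delta.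
have E h : quadratic A b (h *: v + x) - quadratic A b x =
    h * (dot (A *m x - b) v + h * c).
  rewrite [dot (_ - b) v]dotC dotBr /quadratic mulmxDr -scalemxAr.
  rewrite !(dotDl, dotDr, dotZl, dotZr) (dotC b v) /c.
  have -> : dot x (A *m v) = dot v (A *m x) by rewrite dot_mulmx As dotC.
  by field.
rewrite /derive; apply: cvg_lim => //.
have -> : dot (A *m x - b) v = dot (A *m x - b) v + 0 * c by rewrite mul0r addr0.
apply: (@cvg_trans _ ((fun h : R => dot (A *m x - b) v + h * c) @ 0^')%classic).
  apply: near_eq_cvg; near=> h.
  have h0 : h != 0 by near: h; exact: nbhs_dnbhs_neq.
  by rewrite /= E scalerA mulVf// scale1r.
apply: cvgD; first exact: cvg_cst.
apply: cvgM; last exact: cvg_cst.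
by apply: nbhs_dnbhs.
Unshelve. all: by end_near.
Qed.

End InnerProduct.

(** * Matrices diagonal in a common orthonormal basis *)

Section SharedEigenbasis.
Context {R : realType} {n : nat}.
Implicit Types (A F G P : 'M[R]_n) (d e : 'rV[R]_n) (u v : 'cV[R]_n).
Implicit Types (f : R -> R) (s t : R).

Lemma spectral_orthogonal {A P d} : spectral_decomposition A P d ->
  P^T *m P = 1%:M.
Proof. by case=> PP _; apply: mulmx1C. Qed.

Lemma spectral_matfun {A P d} f : spectral_decomposition A P d ->
  spectral_decomposition (matfun f A) P (map_mx f d).
Proof. by move=> S; split; [case: S | exact: matfunE]. Qed.

Lemma spectral_mul {F G P d e} : spectral_decomposition F P d ->
  spectral_decomposition G P e ->
  spectral_decomposition (F *m G) P (\row_i (d 0 i * e 0 i)).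
Proof.
move=> [PP ->] [_ ->]; split=> //.
rewrite !mulmxA -(mulmxA _ P P^T) PP mulmx1.
by rewrite -(mulmxA _ (diag_mx d)) mulmx_diag.
Qed.

Lemma spectral_comm {F G P d e} : spectral_decomposition F P d ->
  spectral_decomposition G P e -> F *m G = G *m F.
Proof.
move=> SF SG; have [_ ->] := spectral_mul SF SG.
have [_ ->] := spectral_mul SG SF.
by congr (_ *m diag_mx _ *m _); apply/matrixP => i j; rewrite !mxE mulrC.
Qed.

Lemma spectral_sym {A P d} : spectral_decomposition A P d -> A^T = A.
Proof. by case=> _ ->; rewrite !trmx_mul trmxK tr_diag_mx mulmxA. Qed.

Lemma spectral_dot {A P d} u : spectral_decomposition A P d ->
  dot u (A *m u) = \sum_i d 0 i * (P *m u) i 0 ^+ 2.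
Proof.
case=> _ ->; rewrite -!mulmxA dot_mulmx trmxK; set w := P *m u.
clearbody w; rewrite dotE mul_diag_mx; apply: eq_bigr => i _.
by rewrite mxE expr2 mulrCA.
Qed.

(** The quadratic form is a sum of squares of the coordinates of u in the basis
P, weighted by the eigenvalues. *)
Lemma spectral_posdef {A P d} : spectral_decomposition A P d ->
  (forall i, 0 < d 0 i) -> sym_posdef A.
Proof.
move=> S d0; split=> [|u u0]; first exact: spectral_sym S.
rewrite (spectral_dot _ S) lt_neqAle sumr_ge0 ?andbT; last first.
  by move=> i _; rewrite mulr_ge0 ?sqr_ge0 ?ltW.
rewrite eq_sym; apply: contra u0; rewrite psumr_eq0 => [/allP H|i _]; last first.
  by rewrite mulr_ge0 ?sqr_ge0 ?ltW.
suff Pu : P *m u = 0.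
  by rewrite -(mul1mx u) -(spectral_orthogonal S) -mulmxA Pu mulmx0.
apply/matrixP => i j; rewrite ord1 [RHS]mxE; apply/eqP.
have := H i (mem_index_enum i).
by rewrite /= mulf_eq0 gt_eqF ?d0//= sqrf_eq0.
Qed.

Lemma spectral_eigenvalue {A P d} i : spectral_decomposition A P d ->
  eigenvalue A (d 0 i).
Proof.
case=> PP ->; apply/eigenvalueP; exists (row i P).
  rewrite -row_mul !mulmxA PP mul1mx.
  by apply/rowP => j; rewrite mul_diag_mx !mxE.
apply/negP => /eqP Pi0; have := congr1 (fun M : 'M[R]_n => M i i) PP.
rewrite !mxE eqxx => /eqP; rewrite big1 ?(eq_sym 0) ?oner_eq0// => j _.
by move/matrixP: Pi0 => /(_ 0 j); rewrite !mxE => ->; rewrite mul0r.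
Qed.

Lemma posdef_eigenvalue_gt0 A s : sym_posdef A -> eigenvalue A s -> 0 < s.
Proof.
move=> [As Apos] /eigenvalueP[v vA v0].
have v0' : v^T != 0 by rewrite -(inj_eq (@trmx_inj _ _ _)) trmxK linear0.
have Av : A *m v^T = s *: v^T by rewrite -{1}As -trmx_mul vA linearZ.
by have := Apos _ v0'; rewrite Av dotZr pmulr_lgt0// dot_gt0.
Qed.

Lemma matpowD {A P d} s t : spectral_decomposition A P d ->
  (forall i, 0 < d 0 i) -> matpow A s *m matpow A t = matpow A (s + t).
Proof.
move=> S d0; pose pw c := spectral_matfun (fun x => x `^ c) S.
rewrite /matpow; have [_ ->] := spectral_mul (pw s) (pw t).
rewrite (matfunE _ S); congr (_ *m diag_mx _ *m _).
by apply/matrixP => i j; rewrite !mxE ord1 powRD//; apply/implyP => _; rewrite gt_eqF.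
Qed.

Lemma matpow1 {A P d} : spectral_decomposition A P d ->
  (forall i, 0 < d 0 i) -> matpow A 1 = A.
Proof.
move=> S d0; rewrite /matpow (matfunE _ S); case: (S) => _ ->.
by congr (_ *m diag_mx _ *m _); apply/matrixP => i j; rewrite !mxE ord1 powRr1 ?ltW.
Qed.

End SharedEigenbasis.

(** * Symmetric matrices of order two *)

Section Plane.
Context {R : realType}.
Implicit Types (A F G H P : 'M[R]_2) (d : 'rV[R]_2) (u v q g : 'cV[R]_2).

Lemma ord2_ind (Q : 'I_2 -> Prop) : Q 0 -> Q 1 -> forall i, Q i.
Proof.
move=> Q0 Q1 [[|[|//]] i2].
- by rewrite (_ : Ordinal i2 = 0)//; apply: val_inj.
- by rewrite (_ : Ordinal i2 = 1)//; apply: val_inj.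
Qed.

Lemma sum_ord2 (f : 'I_2 -> R) : \sum_i f i = f 0 + f 1.
Proof.
rewrite !big_ord_recl big_ord0 addr0; congr (_ + f _).
exact: val_inj.
Qed.

(** In the plane a single eigenvector suffices: its rotation by a right angle
is an eigenvector too, for the eigenvalue that the trace leaves over. Keeping
s in first position lets the caller decide which eigenvalue comes first. *)
Lemma spectral_plane A s : A^T = A -> eigenvalue A s ->
  exists P d, spectral_decomposition A P d /\ d 0 0 = s.
Proof.
move=> As /eigenvalueP[v vA v0].
have v0' : v^T != 0 by rewrite -(inj_eq (@trmx_inj _ _ _)) trmxK linear0.
have N0 : enorm v^T != 0 by rewrite gt_eqF ?enorm_gt0.
pose w : 'rV[R]_2 := (enorm v^T)^-1 *: v.
have wA : w *m A = s *: w by rewrite -scalemxAl vA scalerA mulrC -scalerA.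
have ww : w 0 0 ^+ 2 + w 0 1 ^+ 2 = 1.
  have N2 : v 0 0 ^+ 2 + v 0 1 ^+ 2 = enorm v^T ^+ 2.
    by rewrite sqr_enorm dotE sum_ord2 !mxE !expr2.
  by rewrite !mxE !exprMn -mulrDr N2 -exprMn mulVf ?expr1n.
have A10 : A 1 0 = A 0 1 by rewrite -{1}As mxE.
have w0A : w 0 0 * A 0 0 = s * w 0 0 - w 0 1 * A 0 1.
  apply/eqP; rewrite eq_sym subr_eq eq_sym; apply/eqP.
  by move/matrixP: wA => /(_ 0 0); rewrite [LHS]mxE sum_ord2 A10 [RHS]mxE.
have w1A : w 0 1 * A 1 1 = s * w 0 1 - w 0 0 * A 0 1.
  apply/eqP; rewrite eq_sym subr_eq addrC eq_sym; apply/eqP.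
  by move/matrixP: wA => /(_ 0 1); rewrite [LHS]mxE sum_ord2 [RHS]mxE.
clearbody w.
pose P : 'M[R]_2 := \matrix_(i, j)
  (if i == 0 then w 0 j else if j == 0 then - w 0 1 else w 0 0).
pose d : 'rV[R]_2 := \row_i (if i == 0 then s else A 0 0 + A 1 1 - s).
have PP : P *m P^T = 1%:M.
  apply/matrixP => i j; rewrite !mxE sum_ord2 !mxE.
  by elim/ord2_ind: i; elim/ord2_ind: j => /=; rewrite ?mulr1n ?mulr0n -?ww; ring.
have PA : P *m A = diag_mx d *m P.
  apply/matrixP => i j; rewrite mul_diag_mx !mxE sum_ord2 !mxE.
  by elim/ord2_ind: i; elim/ord2_ind: j => /=; rewrite ?A10; lra.
exists P, d; split; last by rewrite mxE.
split=> //; rewrite -mulmxA -PA mulmxA.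
by rewrite (mulmx1C PP) mul1mx.
Qed.

Lemma det_mx22 A : \det A = A 0 0 * A 1 1 - A 0 1 * A 1 0.
Proof.
have l0 : lift (0 : 'I_2) 0 = 1 by exact: val_inj.
have l1 : lift (1 : 'I_2) 0 = 0 by exact: val_inj.
rewrite (expand_det_row _ 0) sum_ord2 /cofactor !det_mx11 !mxE l0 l1.
by rewrite /= addn0 add0n expr0 expr1 mul1r mulN1r mulrN.
Qed.

(** The expression under the square root is the squared trace minus four times
the determinant, so it is the squared gap of the eigenvalues; the denominator is
then twice the largest eigenvalue. *)
Lemma stepsize_tilde_spectral H P d : spectral_decomposition H P d ->
  d 0 0 <= d 0 1 -> stepsize_tilde H = (d 0 1)^-1.
Proof.
move=> S d01.
have trH : H 0 0 + H 1 1 = d 0 0 + d 0 1.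
  have : \tr H = \tr (diag_mx d).
    by case: (S) => PP ->; rewrite mxtrace_mulC mulmxA PP mul1mx.
  by rewrite mxtrace_diag /mxtrace !sum_ord2.
have detH : H 0 0 * H 1 1 - H 0 1 ^+ 2 = d 0 0 * d 0 1.
  have : \det H = \det (diag_mx d).
    case: (S) => PP ->; rewrite !det_mulmx mulrAC -det_mulmx.
    by rewrite (mulmx1C PP) det1 mul1r.
  rewrite det_mx22 det_diag big_ord_recl big_ord1.
  have H10 : H 1 0 = H 0 1 by rewrite -{1}(spectral_sym S) mxE.
  by rewrite H10 -expr2 => ->; congr (_ * d 0 _); exact: val_inj.
have disc : (H 0 0 - H 1 1) ^+ 2 + 4 * H 0 1 ^+ 2 = (d 0 1 - d 0 0) ^+ 2.
  have -> : (H 0 0 - H 1 1) ^+ 2 + 4 * H 0 1 ^+ 2 =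
      (H 0 0 + H 1 1) ^+ 2 - 4 * (H 0 0 * H 1 1 - H 0 1 ^+ 2) by ring.
  by rewrite trH detH; ring.
rewrite /stepsize_tilde disc trH sqrtr_sqr ger0_norm ?subr_ge0//.
have -> : d 0 0 + d 0 1 + (d 0 1 - d 0 0) = 2 * d 0 1 by ring.
by rewrite invfM mulrA divff ?mul1r.
Qed.

(** Cayley-Hamilton, in the factored form that turns a step of length
1 / d 0 1 into an eigenvector for d 0 0. *)
Lemma spectral_plane_annihilator {A P d} : spectral_decomposition A P d ->
  (A - (d 0 0)%:M) *m (A - (d 0 1)%:M) = 0.
Proof.
move=> S; have [PP AE] := S.
have E (c : R) : A - c%:M = P^T *m (diag_mx d - c%:M) *m P.
  rewrite mulmxBr mulmxBl -AE; congr (_ - _).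
  by rewrite mul_mx_scalar -scalemxAl (spectral_orthogonal S) scalemx1.
rewrite !E !mulmxA -(mulmxA _ P P^T) PP mulmx1 -(mulmxA _ (_ - _) (_ - _)).
suff -> : (diag_mx d - (d 0 0)%:M) *m (diag_mx d - (d 0 1)%:M) = 0.
  by rewrite mulmx0 mul0mx.
apply/matrixP => i j; rewrite !mxE sum_ord2 !mxE.
by elim/ord2_ind: i; elim/ord2_ind: j => /=; rewrite ?mulr1n ?mulr0n; ring.
Qed.

End Plane.

(** * The two stepsizes *)

Section StepsizeTilde.
Context {R : realType} {n : nat}.
Implicit Types (A F G H P : 'M[R]_n) (d : 'rV[R]_n) (u v q g : 'cV[R]_n).

(** An orthonormal family indexed by the dimension is a basis, so passing to
its Gram-type matrix for A is an orthogonal change of coordinates, which keeps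
the eigenvalues and their order. *)
Lemma compression_spectral {A P d} (e : 'I_n -> 'cV[R]_n) :
  spectral_decomposition A P d ->
  (forall i j, dot (e i) (e j) = (i == j)%:R) ->
  exists Q, spectral_decomposition (\matrix_(i, j) dot (e i) (A *m e j)) Q d.
Proof.
move=> [PP AE] ee; pose W : 'M[R]_n := \matrix_(i, j) e j i 0.
have WW : W^T *m W = 1%:M.
  apply/matrixP => i j; rewrite !mxE -ee dotE.
  by apply: eq_bigr => k _; rewrite !mxE.
exists (P *m W); split.
  by rewrite trmx_mul !mulmxA -(mulmxA P) (mulmx1C WW) mulmx1.
transitivity (W^T *m (A *m W)); last by rewrite AE trmx_mul !mulmxA.
apply/matrixP => i j; rewrite mxE dotE [RHS]mxE; apply: eq_bigr => k _.
by rewrite !mxE; congr (_ * _); apply: eq_bigr => l _; rewrite mxE.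
Qed.

(** Moves both powers of F to the same side; this identifies the entries of
Hmx, written with powers 2 r and 2 (1 - r), with inner products of the vectors
F^r q and F^{1-r} g. *)
Lemma dot_matpow {A F P d e} s t u v : spectral_decomposition A P d ->
  spectral_decomposition F P e -> (forall i, 0 < e 0 i) ->
  dot (matpow F s *m u) (A *m (matpow F t *m v)) =
  dot u (matpow F (s + t) *m A *m v).
Proof.
move=> SA SF e0; pose pw c := spectral_matfun (fun x => x `^ c) SF.
have Fs : (matpow F s)^T = matpow F s := spectral_sym (pw s).
rewrite -{1}Fs -dot_mulmx -(matpowD s t SF e0).
by rewrite !mulmxA -(mulmxA _ A) -(spectral_comm (pw t) SA) !mulmxA.
Qed.

(** The step is the one that makes the next vector orthogonal to g for the
bilinear form given by Phi(A). *)
Lemma dot_stepsize_eq0 A (Phi : R -> R) g :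
  dot g (matfun Phi A *m A *m g) != 0 ->
  dot g (matfun Phi A *m (g - stepsize A Phi g *: (A *m g))) = 0.
Proof.
move=> gAg0; rewrite mulmxBr -scalemxAr mulmxA dotBr dotZr.
by rewrite /stepsize divfK// subrr.
Qed.

Lemma stepsize_eigenvector A (Phi : R -> R) g (l : R) :
  A *m g = l *: g -> dot g (matfun Phi A *m g) != 0 ->
  stepsize A Phi g = l^-1.
Proof.
move=> Ag g0; rewrite /stepsize -mulmxA Ag -scalemxAr dotZr.
by rewrite invfM mulrCA divff ?mulr1.
Qed.

End StepsizeTilde.

Section PlaneStep.
Context {R : realType}.
Implicit Types (A P : 'M[R]_2) (d : 'rV[R]_2) (q g : 'cV[R]_2).

(** The hypothesis on q and g says that F^r q and F^{1-r} g are orthogonal,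
where F = Phi(A), since the two powers multiply to F. Their normalizations are
an orthonormal basis in which A has matrix Hmx. *)
Lemma stepsize_tilde_orthogonal {A P d} (Phi : R -> R) r q g :
  spectral_decomposition A P d -> d 0 0 <= d 0 1 ->
  (forall i, 0 < Phi (d 0 i)) ->
  matpow (matfun Phi A) r *m q != 0 ->
  matpow (matfun Phi A) (1 - r) *m g != 0 ->
  dot q (matfun Phi A *m g) = 0 ->
  stepsize_tilde (Hmx A Phi r q g) = (d 0 1)^-1.
Proof.
move=> SA d01 Phi0; set F := matfun Phi A; set u := _ *m q; set v := _ *m g.
move=> u0 v0 qg.
have SF : spectral_decomposition F P (map_mx Phi d) := spectral_matfun Phi SA.
have F0 i : 0 < map_mx Phi d 0 i by rewrite mxE.
have uv : dot u v = 0.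
  have Fr : (matpow F r)^T = matpow F r.
    exact: spectral_sym (spectral_matfun (fun x => x `^ r) SF).
  by rewrite /u -{1}Fr -dot_mulmx mulmxA (matpowD _ _ SF F0) subrKC (matpow1 SF F0).
have nu := enorm_gt0 _ u0; have nv := enorm_gt0 _ v0.
pose e (i : 'I_2) := if i == 0 then (enorm u)^-1 *: u else (enorm v)^-1 *: v.
have ee i j : dot (e i) (e j) = (i == j)%:R.
  elim/ord2_ind: i; elim/ord2_ind: j; rewrite /e /= dotZl dotZr.
  - by rewrite -sqr_enorm; field; rewrite gt_eqF.
  - by rewrite uv !mulr0.
  - by rewrite dotC uv !mulr0.
  - by rewrite -sqr_enorm; field; rewrite gt_eqF.
have [Q SH] := compression_spectral e SA ee.
suff -> : Hmx A Phi r q g = \matrix_(i, j) dot (e i) (A *m e j).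
  exact: stepsize_tilde_spectral SH d01.
have r11 : 2 * r = r + r by ring.
have r22 : 2 * (1 - r) = (1 - r) + (1 - r) by ring.
have r12 : r + (1 - r) = 1 by ring.
have hvu : dot v (A *m u) = dot u (A *m v).
  by rewrite dot_mulmx (spectral_sym SA) dotC.
have huv : dot u (A *m v) = dot q (F *m A *m g).
  by rewrite (dot_matpow _ _ _ _ SA SF F0) r12 (matpow1 SF F0).
apply/matrixP => i j; rewrite /Hmx -/F !mxE.
elim/ord2_ind: i; elim/ord2_ind: j; rewrite /e /= -scalemxAr dotZl dotZr.
- by rewrite r11 -(dot_matpow _ _ _ _ SA SF F0) expr2 invfM -/u; ring.
- by rewrite huv invfM; ring.
- by rewrite hvu huv invfM; ring.
- by rewrite r22 -(dot_matpow _ _ _ _ SA SF F0) expr2 invfM -/v; ring.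
Qed.

End PlaneStep.

(** * Termination *)

Theorem theorem2 (R : realType) (A : 'M[R]_2) (b : 'cV[R]_2)
    (l1 l2 : R) (Psi Psi1 : R -> R) (k0 : nat) (r : R)
    (x g : nat -> 'cV[R]_2) (alpha : nat -> R) (q : 'cV[R]_2)
    (hA : sym_posdef A)
    (hl1 : smallest_eigenvalue A l1) (hl2 : largest_eigenvalue A l2)
    (hPsi : admissible l1 l2 Psi) (hPsi1 : admissible l1 l2 Psi1)
    (hk0 : (2 <= k0)%N)
    (hg : forall k, g k = gradient (quadratic A b) (x k))
    (hx : forall k, running g k -> x k.+1 = x k - alpha k *: g k)
    (halpha0 : 0 < alpha 0%N)
    (halpha : forall k, running g k -> (1 <= k)%N -> k <> k0 -> k <> (k0 - 1)%N ->
       alpha k = stepsize A Psi (g (k - 1)%N))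
    (halpha1 : running g (k0 - 1) ->
       alpha (k0 - 1)%N = stepsize A Psi1 (g (k0 - 2)%N))
    (hq : running g k0 ->
       [/\ (1%:M - alpha (k0 - 2)%N *: A) *m q = g (k0 - 2)%N,
           matpow (matfun Psi1 A) r *m q != 0 &
           matpow (matfun Psi1 A) (1 - r) *m g k0 != 0])
    (halpha2 : running g k0 ->
       alpha k0 = stepsize_tilde (Hmx A Psi1 r q (g k0))) :
  exists j : nat, (j <= k0 + 3)%N /\ g j = 0.
Proof.
(* Negating the conclusion keeps the method running up to iteration k0 + 3. *)
apply: contrapT => noj.
have g0 j : (j <= k0 + 3)%N -> g j != 0.
  by move=> jk; apply/eqP => gj; apply: noj; exists j.
have run k : (k <= k0 + 3)%N -> running g k.
  by move=> kk j jk; apply: g0; exact: leq_trans kk.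
have gE k : g k = A *m x k - b by rewrite hg gradient_quadratic ?hA.1.
have gS k : (k <= k0 + 3)%N -> g k.+1 = g k - alpha k *: (A *m g k).
  move=> kk; rewrite (gE k.+1) hx; last exact: run _ kk.
  by rewrite mulmxBr -scalemxAr addrAC -gE.
have [P [d [SA d0l]]] := spectral_plane _ _ hA.1 hl1.1.
have dl i : l1 <= d 0 i <= l2.
  by rewrite hl1.2 ?hl2.2//; exact: spectral_eigenvalue SA.
have d0 i : 0 < d 0 i by apply: posdef_eigenvalue_gt0 hA (spectral_eigenvalue i SA).
have Psi0 i : 0 < Psi (d 0 i) by case: hPsi => _ _; apply; rewrite in_itv/= dl.
have Psi10 i : 0 < Psi1 (d 0 i) by case: hPsi1 => _ _; apply; rewrite in_itv/= dl.
have d01 : d 0 0 <= d 0 1 by rewrite d0l; case/andP: (dl 1).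
have [k k0E] : exists k, k0 = k.+2 by exists (k0 - 2)%N; rewrite -addn2 subnK.
subst k0; rewrite addn3 !subSS !subn0 in gS run g0 halpha1 hq.
have k2 := run k.+2 ltac:(lia); have [qE q1 q2] := hq k2.
have a0 : alpha k.+1 = stepsize A Psi1 (g k) by apply: halpha1; apply: run; lia.
(* The two factors are swapped so that the one applied last can be moved onto
   q, where it gives the gradient k0 - 2 by the choice of q. *)
have g2 : g k.+2 = (1%:M - alpha k *: A) *m (g k - alpha k.+1 *: (A *m g k)).
  rewrite (gS k.+1); last lia.
  rewrite (gS k); last lia.
  rewrite !mulmxBl !mulmxBr !mul1mx -!scalemxAl -!scalemxAr.
  by rewrite !scalerBr !scalerA (mulrC (alpha k)) !opprD !opprK addrACA.
have SF := spectral_matfun Psi1 SA.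
have qFg : dot q (matfun Psi1 A *m g k.+2) = 0.
  have Bs : (1%:M - alpha k *: A)^T = 1%:M - alpha k *: A.
    by rewrite linearB/= linearZ/= trmx1 hA.1.
  have FB : matfun Psi1 A *m (1%:M - alpha k *: A) =
      (1%:M - alpha k *: A) *m matfun Psi1 A.
    rewrite mulmxBr mulmxBl mulmx1 mul1mx -scalemxAr -scalemxAl.
    by rewrite (spectral_comm SF SA).
  rewrite g2 mulmxA FB -mulmxA dot_mulmx Bs qE a0.
  apply: dot_stepsize_eq0; rewrite gt_eqF//.
  apply: (spectral_posdef (spectral_mul SF SA) _).2; last by apply: g0; lia.
  by move=> i; rewrite !mxE mulr_gt0.
have a2 : alpha k.+2 = (d 0 1)^-1.
  by rewrite (halpha2 k2); exact: stepsize_tilde_orthogonal SA d01 Psi10 q1 q2 qFg.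
(* The step 1 / d 0 1 maps g to a multiple of (A - d 0 1) g. *)
have Ag3 : A *m g k.+3 = d 0 0 *: g k.+3.
  apply/eqP; rewrite -subr_eq0 -mul_scalar_mx -mulmxBl.
  have -> : g k.+3 = - (d 0 1)^-1 *: ((A - (d 0 1)%:M) *m g k.+2).
    rewrite gS ?a2; last lia.
    rewrite mulmxBl mul_scalar_mx scalerBr !scaleNr scalerA mulVf ?gt_eqF//.
    by rewrite scale1r opprK addrC.
  by rewrite -scalemxAr mulmxA (spectral_plane_annihilator SA) mul0mx scaler0.
have Ag4 : A *m g k.+4 = d 0 0 *: g k.+4.
  rewrite gS; last lia.
  by rewrite mulmxBr -scalemxAr Ag3 -scalemxAr Ag3 scalerBr !scalerA [in RHS]mulrC.
have a4 : alpha k.+4 = (d 0 0)^-1.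
  rewrite halpha; [|by apply: run; lia|lia|lia|lia].
  rewrite subn1/=; apply: stepsize_eigenvector => //; rewrite gt_eqF//.
  apply: (spectral_posdef (spectral_matfun Psi SA) _).2; last by apply: g0; lia.
  by move=> i; rewrite mxE.
have /negP[] := g0 k.+4.+1 (leqnn _).
rewrite gS; last lia.
by rewrite Ag4 a4 scalerA mulVf ?gt_eqF// scale1r subrr.
Qed.
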